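(* Let $R\geq 4$ and let $q\geq 4$ be a prime power. Then there exists a linear $[n,n-2R,3]_q$ code with $n=Rq+\lceil R/3\rceil$ and covering radius $R$ which is an $(R,\ell)$-object for some $\ell\geq 1$.
   Context: An $[n,n-r,d]_q$ code is a linear subspace of $F_q^n$ of dimension $n-r$ and minimum Hamming distance $d$; it has covering radius $R$ if every column of $F_q^{r}$ is a linear combination of at most $R$ columns of a parity-check matrix $\mathbf{H}$, with $R$ minimal. For $0\leq\ell\leq R$, a partition of the column set of $\mathbf{H}$ into nonempty subsets is an $(R,\ell)$-partition if every column of $F_q^{r}$ (including the zero column) equals a linear combination with nonzero coefficients of at least $\ell$ and at most $R$ columns of $\mathbf{H}$ belonging to distinct subsets. The code is an $(R,\ell)$-object if some parity-check matrix of it admits an $(R,\ell)$-partition. *)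

(* Defs.v *)
From HB Require Import structures.
From mathcomp Require Import all_boot all_order all_algebra.

Set Implicit Arguments.
Unset Strict Implicit.
Unset Printing Implicit Defensive.

Import GRing.Theory.
Local Open Scope ring_scope.

(* Rounded-up quotient; leq_ceil_div is its characteristic property.          *)
Definition ceil_div (m d : nat) : nat := ((m + d.-1) %/ d)%N.

Lemma leq_ceil_div (m d k : nat) :
  (0 < d)%N -> (ceil_div m d <= k)%N = (m <= k * d)%N.
Proof.
case: d => // d _; rewrite /ceil_div -ltnS ltn_divLR // mulSn /=.
by rewrite [(d.+1 + _)%N]addnC addnS ltnS leq_add2r.
Qed.

Section Codes.
Variable F : finFieldType.

Definition hdist (n : nat) (x y : 'rV[F]_n) : nat :=
  #|[set i : 'I_n | x 0 i != y 0 i]|.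

Definition min_distance (n : nat) (C : {vspace 'rV[F]_n}) (d : nat) : Prop :=
  (exists x y, [/\ x \in C, y \in C, x != y & hdist x y = d]) /\
  (forall x y, x \in C -> y \in C -> x != y -> (d <= hdist x y)%N).

Definition linear_code (n k d : nat) (C : {vspace 'rV[F]_n}) : Prop :=
  \dim C = k /\ min_distance C d.

(* Full row rank forces r = n - \dim C.                                       *)
Definition parity_check (n r : nat) (H : 'M[F]_(r, n))
    (C : {vspace 'rV[F]_n}) : Prop :=
  row_free H /\ forall x : 'rV[F]_n, (x \in C) = (H *m x^T == 0).

Definition covers (n r : nat) (H : 'M[F]_(r, n)) (R : nat) : Prop :=
  forall s : 'cV[F]_r, exists (J : {set 'I_n}) (c : 'I_n -> F),
    (#|J| <= R)%N /\ s = \sum_(j in J) c j *: col j H.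

Definition covering_radius (n : nat) (C : {vspace 'rV[F]_n}) (R : nat) : Prop :=
  exists (r : nat) (H : 'M[F]_(r, n)),
    [/\ parity_check H C, covers H R & forall R', covers H R' -> (R <= R')%N].

(* Columns are represented by their indices, which is the same as            *)
(* partitioning the set of columns as soon as these are pairwise distinct,   *)
(* e.g. for minimum distance at least 3.                                     *)
Definition Rl_partition (n r : nat) (H : 'M[F]_(r, n)) (R l : nat)
    (P : {set {set 'I_n}}) : Prop :=
  [/\ (l <= R)%N, partition P [set: 'I_n] &
      forall s : 'cV[F]_r, exists (J : {set 'I_n}) (c : 'I_n -> F),
        [/\ (l <= #|J| <= R)%N, {in J &, injective (pblock P)},
            {in J, forall j, c j != 0} & s = \sum_(j in J) c j *: col j H]].

Definition Rl_object (n : nat) (C : {vspace 'rV[F]_n}) (R l : nat) : Prop :=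
  exists (r : nat) (H : 'M[F]_(r, n)) (P : {set {set 'I_n}}),
    parity_check H C /\ Rl_partition H R l P.

End Codes.

(* Main.v *)
(* Direct sums reduce the theorem to R = 2 and R = 3, since covering radii,
   lengths and codimensions add up: 4 = 2 + 2 and R = (R - 3) + 3 otherwise.
   For R = 2 take the q points (1,b,0,0) of a line and the q + 1 points
   (0,a^2,1,a), (0,0,0,1); for R = 3 bend the affine line into the parabola
   (1,b,b^2,0,0,0), add the line (0,0,c,1,0,0), and keep the q + 1 points
   (0,a^2,0,0,1,a), (0,0,0,0,0,1).  The three families project bijectively where
   needed, so a generic syndrome uses one column of each; the degenerate ones
   are reached because, for q >= 4, every affine point of the plane lies on the
   parabola or on one of its secants.  The partition into singletons is an
   (R,1)-partition: the zero syndrome is a combination of three columns, since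
   there is a codeword of weight 3. *)
Require Import Defs.
From HB Require Import structures.
From mathcomp Require Import all_boot all_order all_algebra.
From mathcomp Require Import ring zify.

Set Implicit Arguments.
Unset Strict Implicit.
Unset Printing Implicit Defensive.

Import GRing.Theory.

(** * Hamming weight and direct sums of parity-check matrices *)

Section Weight.
Local Open Scope ring_scope.
Variable F : finFieldType.

Definition wt (n : nat) (x : 'cV[F]_n) : nat := (\sum_i (x i 0 != 0)%R)%N.

Lemma wtE n (x : 'cV[F]_n) : wt x = #|[set i | x i 0 != 0]|.
Proof. by rewrite /wt -sum1dep_card [RHS]big_mkcond. Qed.

Lemma wt0 n : wt (0 : 'cV[F]_n) = 0%N.
Proof. by rewrite /wt big1 // => i _; rewrite mxE eqxx. Qed.

Lemma wt_gt0 n (x : 'cV[F]_n) : (0 < wt x)%N = (x != 0).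
Proof.
apply/idP/idP => [|x0]; first by apply: contraTneq => ->; rewrite wt0.
have /existsP[i xi] : [exists i, x i 0 != 0].
  rewrite -negb_forall; apply: contra_neqN x0 => /forallP x0.
  by apply/colP => i; rewrite mxE; apply/eqP.
by rewrite /wt (bigD1 i) //= xi.
Qed.

Lemma wt_col_mx m n (x : 'cV[F]_m) (y : 'cV[F]_n) :
  wt (col_mx x y) = (wt x + wt y)%N.
Proof.
rewrite /wt big_split_ord /=; congr (_ + _)%N; apply: eq_bigr => i _.
  by rewrite col_mxEu.
by rewrite col_mxEd.
Qed.

Lemma wtD n (x y : 'cV[F]_n) : (wt (x + y)%R <= wt x + wt y)%N.
Proof.
rewrite /wt -big_split /=; apply: leq_sum => i _; rewrite mxE.
by case: (eqVneq (x i 0) 0) => [->|_]; rewrite ?add0r //; case: (_ == 0).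
Qed.

Lemma wt_delta n (a : F) (i : 'I_n) : (wt (a *: delta_mx i 0)%R <= 1)%N.
Proof.
rewrite wtE; apply: (@leq_trans #|[set i]|); last by rewrite cards1.
apply/subset_leq_card/subsetP => j.
rewrite !inE !mxE eqxx andbT.
by case: (j == i); rewrite ?mulr0 ?eqxx.
Qed.

Lemma wt_hdist n (x y : 'rV[F]_n) : hdist x y = wt (x - y)^T.
Proof. by rewrite wtE; apply: eq_card => i; rewrite !inE !mxE subr_eq0. Qed.

(* All four clauses are stable under direct sums. *)
Definition good_matrix (R n r : nat) (H : 'M[F]_(r, n)) : Prop :=
  [/\ forall s, exists2 x, H *m x = s & (wt x <= R)%N,
      exists s, forall x, H *m x = s -> (R <= wt x)%N,
      forall x, H *m x = 0 -> x != 0 -> (3 <= wt x)%N &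
      exists2 x, H *m x = 0 & wt x = 3].

Definition good_code (R n r : nat) : Prop :=
  exists H : 'M[F]_(r, n), good_matrix R H.

(** Over a block-diagonal matrix the weights of the two halves add, hence so do both bounds on the
    radius. A nonzero kernel word is nonzero in some half, and [z1] padded with zeros keeps weight
    3. *)
Lemma good_codeD R1 n1 r1 R2 n2 r2 :
  good_code R1 n1 r1 -> good_code R2 n2 r2 ->
  good_code (R1 + R2) (n1 + n2) (r1 + r2).
Proof.
move=> [H1 [cov1 [s1 low1] dist1 [z1 Hz1 wz1]]].
move=> [H2 [cov2 [s2 low2] dist2 _]].
have mulH x1 x2 : block_mx H1 0 0 H2 *m col_mx x1 x2
    = col_mx (H1 *m x1) (H2 *m x2) :> 'cV_ _.
  by rewrite mul_block_col !mul0mx addr0 add0r.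
exists (block_mx H1 0 0 H2); split.
- move=> s; have [x1 Hx1 wx1] := cov1 (usubmx s).
  have [x2 Hx2 wx2] := cov2 (dsubmx s).
  exists (col_mx x1 x2); first by rewrite mulH Hx1 Hx2 vsubmxK.
  by rewrite wt_col_mx leq_add.
- exists (col_mx s1 s2) => x; rewrite -(vsubmxK x) mulH => /eq_col_mx[Hx1 Hx2].
  by rewrite wt_col_mx leq_add ?low1 ?low2.
- move=> x; rewrite -(vsubmxK x) mulH -[0]vsubmxK !linear0.
  move=> /eq_col_mx[Hx1 Hx2]; rewrite wt_col_mx.
  have [x10|x10] := eqVneq (usubmx x) 0; last first.
    by move=> _; apply: leq_trans (leq_addr _ _); apply: dist1.
  have [x20|x20] := eqVneq (dsubmx x) 0; first by rewrite x10 x20 col_mx0 eqxx.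
  by move=> _; apply: leq_trans (leq_addl _ _); apply: dist2.
- by exists (col_mx z1 0); rewrite ?wt_col_mx ?wz1 ?wt0 // mulH Hz1 mulmx0 col_mx0.
Qed.

(** * From weights to covering radius and partitions *)

Lemma mulmx_sum_supp n r (H : 'M[F]_(r, n)) (x : 'cV[F]_n) :
  H *m x = \sum_(j in [set i | x i 0 != 0]) x j 0 *: col j H.
Proof.
apply/colP => i; rewrite mxE summxE [RHS]big_mkcond; apply: eq_bigr => j _ /=.
by rewrite inE; case: eqVneq => [->|_]; rewrite ?mulr0 //= !mxE mulrC.
Qed.

Lemma covers_wt n r (H : 'M[F]_(r, n)) R :
  covers H R <-> forall s, exists2 x, H *m x = s & (wt x <= R)%N.
Proof.
split=> cov s; last first.
  have [x <- wx] := cov s; exists [set i | x i 0 != 0], (fun i => x i 0).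
  by rewrite -wtE -mulmx_sum_supp.
have [J [c [cJ ->]]] := cov s; exists (\col_i (if i \in J then c i else 0)).
  apply/colP => i; rewrite mxE summxE [RHS]big_mkcond; apply: eq_bigr => j _.
  by rewrite !mxE; case: ifP; rewrite ?mulr0 // mulrC.
apply: leq_trans cJ; rewrite wtE; apply/subset_leq_card/subsetP => i.
by rewrite !inE mxE; case: ifP => //; rewrite eqxx.
Qed.

Definition singletons (n : nat) : {set {set 'I_n}} := [set [set i] | i : 'I_n].

Lemma partition_singletons n : partition (singletons n) [set: 'I_n].
Proof.
apply/and3P; split.
- rewrite eqEsubset subsetT /=; apply/subsetP => i _; apply/bigcupP.
  by exists [set i]; rewrite ?set11 // imset_f.
- apply/trivIsetP => _ _ /imsetP[i _ ->] /imsetP[j _ ->] ij.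
  by rewrite disjoints1 inE; apply: contraNneq ij => ->.
- by apply/imsetP => -[i _ /setP/(_ i)]; rewrite !inE eqxx.
Qed.

Lemma pblock_singletons n (i : 'I_n) : pblock (singletons n) i = [set i].
Proof.
have /and3P[_ triv _] := partition_singletons n.
by apply: def_pblock (set11 i); rewrite ?imset_f.
Qed.

(** The columns span the whole space, so a row vector orthogonal to all of them kills every unit
    vector. *)
Lemma good_matrix_row_free R n r (H : 'M[F]_(r, n)) :
  good_matrix R H -> row_free H.
Proof.
case=> cov _ _ _; apply: inj_row_free => u uH; apply/rowP => i.
have [x Hx _] := cov (delta_mx i 0).
have /matrixP/(_ 0 0) : u *m delta_mx i 0 = 0 :> 'M_1.
  by rewrite -Hx mulmxA uH mul0mx.
by rewrite -colE !mxE.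
Qed.

Lemma good_code_covering R n r : (3 <= R)%N -> good_code R n r ->
  exists C : {vspace 'rV[F]_n},
    [/\ linear_code (n - r) 3 C, covering_radius C R &
        exists l : nat, (1 <= l)%N /\ Rl_object C R l].
Proof.
move=> R3 [H Hgood]; have rfH := good_matrix_row_free Hgood.
case: Hgood => cov [s0 low] dist [z Hz wz].
pose f : 'Hom('rV[F]_n, 'rV[F]_r) := linfun (mulmxr H^T).
have fE x : f x = x *m H^T by rewrite lfunE.
have inC x : (x \in lker f) = (H *m x^T == 0).
  by rewrite memv_ker fE -(inj_eq (can_inj (@trmxK _ _ _))) trmx_mul trmxK trmx0.
have pcH : parity_check H (lker f) by [].
exists (lker f); split.
- split; last split.
  (* Covering makes the syndrome map [f] onto, so rank-nullity gives dimension [n - r]. *)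
  + have := limg_ker_dim f fullv; rewrite capfv.
    have -> : (f @: fullv)%VS = fullv.
      apply/eqP; rewrite eqEsubv subvf /=; apply/subvP => s _.
      have [x Hx _] := cov s^T.
      by rewrite -[s]trmxK -Hx trmx_mul -fE memv_img ?memvf.
    by rewrite !dimvf /dim /= !mul1n => /(congr1 (subn^~ r)); rewrite addnK.
  + exists z^T, 0; split; first by rewrite inC trmxK Hz.
    * by rewrite mem0v.
    * by rewrite trmx_eq0 -wt_gt0 wz.
    * by rewrite wt_hdist subr0 trmxK.
  + move=> x y xC yC xy; rewrite wt_hdist; apply: dist.
      by apply/eqP; rewrite -inC rpredB.
    by rewrite trmx_eq0 subr_eq0.
- exists r, H; split=> //; first exact/covers_wt.
  move=> R' /covers_wt/(_ s0)[x Hx]; apply: leq_trans; exact: low.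
- exists 1%N; split=> //; exists r, H, (singletons n); split=> //.
  split; [exact: leq_trans R3 | exact: partition_singletons | move=> s].
  (* The empty combination is not allowed for the zero syndrome; the codeword [z] of weight 3
     replaces it, as [3 <= R]. *)
  have [x Hx /andP[x1 xR]] : exists2 x, H *m x = s & (1 <= wt x <= R)%N.
    have [->|s0'] := eqVneq s 0; first by exists z; rewrite ?wz.
    have [x Hx wx] := cov s; exists x; rewrite ?wx ?andbT ?wt_gt0 //.
    by apply: contraNneq s0' => x0; rewrite -Hx x0 mulmx0.
  exists [set i | x i 0 != 0], (fun i => x i 0); split.
  + by rewrite -wtE x1.
  + by move=> i j _ _; rewrite !pblock_singletons => /set1_inj.
  + by move=> i; rewrite inE.
  + by rewrite -mulmx_sum_supp.
Qed.

(* The hypothesis on g bounds the covering radius from below: every combination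
   giving the all-one syndrome has a column not vanishing at g k, for each k, and
   these columns are distinct. *)
Lemma good_family (I : finType) (R r : nat) (v : I -> 'cV[F]_r) :
  (forall s, exists2 l : seq (F * I), (size l <= R)%N &
     \sum_(p <- l) p.1 *: v p.2 = s) ->
  (exists g : 'I_R -> 'I_r, forall i k k',
     v i (g k) 0 != 0 -> v i (g k') 0 != 0 -> k = k') ->
  (forall i j a, v i = a *: v j -> i = j) ->
  (exists i j k a b c, [/\ i != j, i != k, a != 0 &
     a *: v i + b *: v j + c *: v k = 0]) ->
  good_code R #|I| r.
Proof.
move=> cov [g low] ind [i0 [j0 [k0 [a0 [b0 [c0 [ij ik a0N0 dep]]]]]]].
pose H : 'M[F]_(r, #|I|) := \matrix_(i, j) v (enum_val j) i 0.
have colH j : col j H = v (enum_val j) by apply/colP => i; rewrite !mxE.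
pose word (l : seq (F * I)) : 'cV[F]_#|I| :=
  \sum_(p <- l) p.1 *: delta_mx (enum_rank p.2) 0.
have Hword l : H *m word l = \sum_(p <- l) p.1 *: v p.2.
  rewrite /word mulmx_sumr; apply: eq_bigr => p _.
  by rewrite -scalemxAr -colE colH enum_rankK.
have wt_word l : (wt (word l) <= size l)%N.
  rewrite /word; elim: l => [|p l IH]; first by rewrite big_nil wt0.
  rewrite big_cons; apply: leq_trans (wtD _ _) _.
  by apply: (leq_add (wt_delta _ _) IH).
have v_neq0 i : v i != 0.
  (* A zero column is 0 times itself and, by [ind], would equal no index but its own: all indices
     would coincide, against [i0 != j0]. *)
  apply/eqP => vi0; have vi j : i = j by apply: (ind _ _ 0); rewrite scale0r.
  by move: ij; rewrite -(vi i0) -(vi j0) eqxx.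
have dist x : H *m x = 0 -> x != 0 -> (3 <= wt x)%N.
  rewrite -wt_gt0 wtE mulmx_sum_supp.
  set S := [set i | _] => Hx /card_gt0P[i iS].
  (* A support of size 1 would give a zero column, one of size 2 two proportional columns. *)
  rewrite leqNgt; apply/negP; rewrite (cardsD1 i) iS add1n !ltnS => S1.
  have xi : x i 0 != 0 by move: iS; rewrite inE.
  move: Hx; rewrite (bigD1 i) //=; rewrite (eq_bigl (mem (S :\ i))); last first.
    by move=> j; rewrite !inE andbC.
  have [/eqP/cards1P[j Sj]|S0] := eqVneq #|S :\ i| 1%N; last first.
    have /eqP : #|S :\ i| = 0%N by case: #|_| S1 S0 => [|[]].
    rewrite cards_eq0 => /eqP ->; rewrite big_set0 addr0 colH => /eqP.
    by rewrite scaler_eq0 (negPf xi) (negPf (v_neq0 _)).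
  rewrite Sj big_set1 !colH => /eqP; rewrite addr_eq0 => /eqP e.
  have /enum_val_inj eij : enum_val i = enum_val j.
    apply: (ind _ _ (- (x j 0 / x i 0))).
    rewrite -[LHS](scalerK xi) e scalerN scalerA scaleNr.
    by rewrite [_^-1 * _]mulrC.
  by move/setP/(_ i): Sj; rewrite !inE eij !eqxx.
exists H; split=> //.
- move=> s; have [l sl <-] := cov s; exists (word l); rewrite ?Hword //.
  exact: leq_trans sl.
- exists (const_mx 1) => x Hx.
  have hit k : exists j, (x j 0 != 0) && (H (g k) j != 0).
    apply/existsP; apply/contraT; rewrite negb_exists => /forallP no.
    move/colP/(_ (g k)): Hx; rewrite !mxE big1 => [/eqP|j _].
      by rewrite eq_sym oner_eq0.
    have := no j; rewrite negb_and !negbK => /orP[]/eqP ->;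
      by rewrite ?mulr0 ?mul0r.
  pose h k := xchoose (hit k).
  have hP k : (x (h k) 0 != 0) && (H (g k) (h k) != 0) := xchooseP (hit k).
  have h_inj : injective h.
    move=> k k' e; have /andP[_ Hk] := hP k; have /andP[_] := hP k'.
    by rewrite -e; move: Hk; rewrite !mxE; apply: low.
  rewrite wtE -[X in (X <= _)%N](card_ord R) -(card_imset _ h_inj).
  apply/subset_leq_card/subsetP => _ /imsetP[k _ ->].
  by rewrite inE; have /andP[] := hP k.
(* Three terms bound the weight by 3, and [dist] gives equality once [z] is nonzero: its entry at
   [i0] is [a0]. *)
- pose z := word [:: (a0, i0); (b0, j0); (c0, k0)].
  have Hz : H *m z = 0 by rewrite Hword !big_cons big_nil addr0 addrA.
  exists z => //; apply/eqP; rewrite eqn_leq wt_word dist //.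
  apply: contraNneq a0N0 => /colP/(_ (enum_rank i0)).
  rewrite /z /word !big_cons big_nil !mxE !eqxx !(inj_eq enum_rank_inj).
  by rewrite (negPf ij) (negPf ik) /= mulr1 !mulr0 !addr0 => ->.
Qed.

End Weight.

(** * Secants of the parabola *)

Section Blocks.
Local Open Scope ring_scope.
Variable F : finFieldType.
Hypothesis F4 : (4 <= #|F|)%N.

(** This is where [q >= 4] enters: [0], [1], [t] are distinct, and moreover [t ^+ 2 != 1]. *)
Lemma ex_neq01N1 : exists t : F, [/\ t != 0, t != 1 & t != -1].
Proof.
have : ~~ ([set: F] \subset [set 0; 1; -1]).
  apply/negP => /subset_leq_card; rewrite cardsT leqNgt => /negP; apply.
  apply: leq_ltn_trans F4; apply: leq_trans (leq_card_setU _ _) _.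
  by rewrite cards1 cards2; case: eqP.
case/subsetPn => t _; rewrite !inE !negb_or => /andP[/andP[t0 t1] tN1].
by exists t.
Qed.

(* The abscissas u, v of the endpoints of a secant through the affine point (X,Y)
   are the solutions of (u - X) (v - X) = X^2 - Y. *)
Lemma parabola_secant (x y z : F) : x != 0 -> exists l m a b,
  [/\ x = l + m, y = l * a + m * b & z = l * a ^+ 2 + m * b ^+ 2].
Proof.
move=> x0; set w := (y / x) ^+ 2 - z / x.
have zE : z = x * ((y / x) ^+ 2 - w) by rewrite /w; field.
have [w0|w0] := eqVneq w 0.
  exists x, 0, (y / x), 0; rewrite zE w0; split; by [ring | field].
(* Off the parabola, the endpoints [X + t] and [X + w / t] are distinct when [t ^+ 2 != w]. *)
have [t t0 tw] : exists2 t : F, t != 0 & t ^+ 2 - w != 0.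
  have [t [t0 t1 tN1]] := ex_neq01N1.
  have [w1|w1] := eqVneq w 1; last first.
    by exists 1; rewrite ?oner_neq0 // expr1n subr_eq0 eq_sym.
  by exists t; rewrite // w1 subr_eq0 sqrf_eq1 negb_or t1.
exists (- (x * w / (t ^+ 2 - w))), (x * t ^+ 2 / (t ^+ 2 - w)).
exists (y / x + t), (y / x + w / t).
by rewrite zE; split; field; rewrite ?x0 ?t0 ?tw.
Qed.

(** The affine points (1,a,a^2) of the conic xz = y^2, with its last point (0,0,1) replaced by
    (0,1,0), so that (x,y) runs once through the projective line. *)
Definition conic_x (k : option F) : F := if k is Some _ then 1 else 0.
Definition conic_y (k : option F) : F := if k is Some a then a else 1.
Definition conic_z (k : option F) : F := if k is Some a then a ^+ 2 else 0.

Lemma conic_project (x y : F) :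
  exists l k, x = l * conic_x k /\ y = l * conic_y k.
Proof.
have [->|x0] := eqVneq x 0; first by exists y, None; rewrite mulr0 mulr1.
by exists x, (Some (y / x)); split=> /=; [ring | field].
Qed.

Lemma conic_secant (x y z : F) : (x != 0) || (y != 0) -> exists l m k k',
  [/\ x = l * conic_x k + m * conic_x k', y = l * conic_y k + m * conic_y k' &
      z = l * conic_z k + m * conic_z k'].
Proof.
have [-> /= y0|x0 _] := eqVneq x 0; last first.
  have [l [m [a [b [xE yE zE]]]]] := parabola_secant y z x0.
  by exists l, m, (Some a), (Some b); split; rewrite //= !mulr1.
have [->|z0] := eqVneq z 0.
  by exists y, 0, None, None; split=> /=; ring.
(* The chord from 0 to [z / y] has slope [z / y], the direction of (0,y,z). *)
exists (y ^+ 2 / z), (- (y ^+ 2 / z)), (Some (z / y)), (Some 0).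
by split=> /=; field; rewrite ?z0 ?y0.
Qed.

Lemma conic_inj t k k' :
  conic_x k = t * conic_x k' -> conic_y k = t * conic_y k' -> k = k'.
Proof.
case: k k' => [a|] [b|] //=.
- by rewrite mulr1 => <- ->; rewrite mul1r.
- by rewrite mulr0 => /eqP; rewrite oner_eq0.
- by rewrite mulr1 => <- /eqP; rewrite mul0r oner_eq0.
Qed.

Lemma conic_neq0 k : conic_x k = 0 -> conic_y k = 0 -> False.
Proof. by case: k => [a|] /= /eqP + /eqP; rewrite ?oner_eq0. Qed.

(** * The block of radius 2 *)

Definition vec r (s : seq F) : 'cV[F]_r := \col_i s`_i.

Lemma vecE r (u : 'cV[F]_r.+1) : u = vec r.+1 (mkseq (fun i => u (inord i) 0) r.+1).
Proof. by apply/colP => i; rewrite mxE nth_mkseq // inord_val. Qed.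

Lemma vec_scale_inj r (s t : seq F) (a : F) :
  vec r s = a *: vec r t -> forall i, (i < r)%N -> s`_i = a * t`_i.
Proof. by move=> /colP e i ir; have := e (Ordinal ir); rewrite !mxE. Qed.

Ltac by_coords := rewrite !big_cons big_nil addr0; apply/colP;
  let i := fresh "i" in move=> i; rewrite !mxE; move: i;
  case=> [[|[|[|[|[|[|]]]]]]] //= _.

Definition column2 (p : F + option F) : 'cV[F]_4 :=
  match p with
  | inl b => vec 4 [:: 1; b; 0; 0]
  | inr k => vec 4 [:: 0; conic_z k; conic_x k; conic_y k]
  end.

Lemma column2_inj p p' a : column2 p = a *: column2 p' -> p = p'.
Proof.
case: p p' => [b|k] [b'|k'] /vec_scale_inj e.
- have := e 1%N isT; have /= := e 0%N isT; rewrite mulr1 => <- ->.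
  by rewrite mul1r.
- by have /eqP := e 0%N isT; rewrite /= mulr0 oner_eq0.
- have := e 3%N isT; have := e 2%N isT; rewrite /= mulr0.
  by move=> kx /(conic_neq0 kx).
- by rewrite (conic_inj (e 2%N isT) (e 3%N isT)).
Qed.

Lemma column2_cover s :
  exists2 l : seq (F * (F + option F)), (size l <= 2)%N &
    \sum_(p <- l) p.1 *: column2 p.2 = s.
Proof.
(* Generalisation starts from the last pattern, so the syndrome reads (a,z,x,y). *)
rewrite (vecE s) /mkseq /=; move: (s _ _) (s _ _) (s _ _) (s _ _) => y x z a.
have [->|a0] := eqVneq a 0; last first.
  have [l [k [xE yE]]] := conic_project x y.
  exists [:: (a, inl ((z - l * conic_z k) / a)); (l, inr k)] => //.
  rewrite !big_cons big_nil addr0; apply/colP => -[[|[|[|[|]]]]] //= ?;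
    rewrite !mxE /= ?xE ?yE; by [ring | field].
have [/andP[/eqP-> /eqP->]|] := boolP ((x == 0) && (y == 0)).
  exists [:: (z, inl 1); (- z, inl 0)] => //.
  rewrite !big_cons big_nil addr0; apply/colP => -[[|[|[|[|]]]]] //= ?;
    rewrite !mxE /=; ring.
rewrite negb_and => /(conic_secant z) [l [m [k [k' [xE yE zE]]]]].
exists [:: (l, inr k); (m, inr k')] => //.
rewrite !big_cons big_nil addr0; apply/colP => -[[|[|[|[|]]]]] //= ?;
  rewrite !mxE /= ?xE ?yE ?zE; ring.
Qed.

Lemma good_code2 : good_code F 2 (2 * #|F| + 1) 4.
Proof.
have -> : (2 * #|F| + 1 = #|{: F + option F}|)%N.
  by rewrite card_sum card_option mul2n -addnn addn1 addnS.
apply: (@good_family _ _ _ _ column2 column2_cover).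
(* Coordinates 0 and 2: the first vanishes on the conic family, the second on the line. *)
- exists (fun k : 'I_2 => inord k.*2) => p k k'; rewrite /column2.
  case: p => [b|c]; case: k k' => [[|[|]]] // ? [[|[|]]] // ?;
    rewrite !mxE !inordK //= ?eqxx // => _ _; exact: val_inj.
- exact: column2_inj.
- have [t [t0 t1 _]] := ex_neq01N1.
  (* The affine dependency between the points 0, 1, t of a line. *)
  exists (inl 0), (inl 1), (inl t), (t - 1), (- t), 1.
  split; rewrite ?subr_eq0 //.
  + by rewrite eq_sym; apply/eqP => -[/eqP]; rewrite oner_eq0.
  + by apply: contraNneq t0 => -[<-].
  + apply/colP => -[[|[|[|[|]]]]] //= ?; rewrite !mxE /=; ring.
Qed.

(** * The block of radius 3 *)

Definition column3 (p : F + F + option F) : 'cV[F]_6 :=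
  match p with
  | inl (inl b) => vec 6 [:: 1; b; b ^+ 2; 0; 0; 0]
  | inl (inr c) => vec 6 [:: 0; 0; c; 1; 0; 0]
  | inr k => vec 6 [:: 0; conic_z k; 0; 0; conic_x k; conic_y k]
  end.

Lemma column3_inj p p' a : column3 p = a *: column3 p' -> p = p'.
Proof.
case: p p' => [[b|c]|k] [[b'|c']|k'] /vec_scale_inj e.
- have := e 1%N isT; have /= := e 0%N isT; rewrite mulr1 => <- ->.
  by rewrite mul1r.
- by have /eqP := e 0%N isT; rewrite /= mulr0 oner_eq0.
- by have /eqP := e 0%N isT; rewrite /= mulr0 oner_eq0.
- by have /eqP := e 3%N isT; rewrite /= mulr0 oner_eq0.
- have := e 2%N isT; have /= := e 3%N isT; rewrite mulr1 => <- ->.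
  by rewrite mul1r.
- by have /eqP := e 3%N isT; rewrite /= mulr0 oner_eq0.
- have := e 5%N isT; have := e 4%N isT; rewrite /= mulr0.
  by move=> kx /(conic_neq0 kx).
- have := e 5%N isT; have := e 4%N isT; rewrite /= mulr0.
  by move=> kx /(conic_neq0 kx).
- by rewrite (conic_inj (e 4%N isT) (e 5%N isT)).
Qed.

Lemma column3_cover s :
  exists2 l : seq (F * (F + F + option F)), (size l <= 3)%N &
    \sum_(p <- l) p.1 *: column3 p.2 = s.
Proof.
rewrite (vecE s) /mkseq /=.
move: (s _ _) (s _ _) (s _ _) (s _ _) (s _ _) (s _ _) => y x d w z a.
have [l [k [xE yE]]] := conic_project x y.
(* In the syndrome (a,z,w,d,x,y), removing the conic column fixed by (x,y) leaves (a,e,w,d,0,0). *)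
set e := z - l * conic_z k.
have zE : z = e + l * conic_z k by rewrite /e subrK.
have [a0|a0] := eqVneq a 0; last first.
  have [d0|d0] := eqVneq d 0; last first.
    exists [:: (a, inl (inl (e / a))); (d, inl (inr ((w - e ^+ 2 / a) / d)));
               (l, inr k)] => //.
    by by_coords; rewrite ?zE ?xE ?yE; field; rewrite ?a0 ?d0.
  (* Without the line family, (a,e,w) is put on a secant of the parabola. *)
  have [m [n [b [c [aE eE wE]]]]] := parabola_secant e w a0.
  exists [:: (m, inl (inl b)); (n, inl (inl c)); (l, inr k)] => //.
  by by_coords; rewrite ?zE ?xE ?yE ?aE ?eE ?wE ?d0; ring.
have [/andP[/eqP x0 /eqP y0]|xy0] := boolP ((x == 0) && (y == 0)).
  have [d0|d0] := eqVneq d 0; last first.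
    exists [:: (z, inl (inl 1)); (- z, inl (inl 0)); (d, inl (inr ((w - z) / d)))].
      by [].
    by by_coords; rewrite ?a0 ?x0 ?y0; by [ring | field].
  have [t [t0 t1 _]] := ex_neq01N1.
  (* Only (0,z,w) remains: a Vandermonde system at the parabola points 0, 1, t. *)
  pose n := (w - z) / (t ^+ 2 - t); pose m := z - n * t.
  exists [:: (- m - n, inl (inl 0)); (m, inl (inl 1)); (n, inl (inl t))] => //.
  have t2 : t ^+ 2 - t != 0 by rewrite subr_eq0 expr2 -{3}[t]mulr1 (inj_eq (mulfI t0)).
  by by_coords; rewrite ?a0 ?d0 ?x0 ?y0 /m /n; by [ring | field].
have [|m [n [k1 [k2 [x2E y2E z2E]]]]] := conic_secant z (x := x) (y := y).
  by rewrite -negb_and.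
have [d0|d0] := eqVneq d 0; last first.
  exists [:: (d, inl (inr (w / d))); (m, inr k1); (n, inr k2)] => //.
  by by_coords; rewrite ?a0 ?x2E ?y2E ?z2E; by [ring | field].
have [w0|w0] := eqVneq w 0.
  exists [:: (m, inr k1); (n, inr k2)] => //.
  by by_coords; rewrite ?a0 ?d0 ?w0 ?x2E ?y2E ?z2E; ring.
have [e0|e0] := eqVneq e 0.
  exists [:: (w, inl (inr 1)); (- w, inl (inr 0)); (l, inr k)] => //.
  by by_coords; rewrite ?a0 ?d0 ?zE ?e0 ?xE ?yE; ring.
(* A chord of slope [w / e] produces (0,e,w). *)
exists [:: (e ^+ 2 / w, inl (inl (w / e))); (- (e ^+ 2 / w), inl (inl 0));
           (l, inr k)] => //.
by by_coords; rewrite ?a0 ?d0 ?zE ?xE ?yE; field; rewrite ?e0 ?w0.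
Qed.

Lemma good_code3 : good_code F 3 (3 * #|F| + 1) 6.
Proof.
have -> : (3 * #|F| + 1 = #|{: F + F + option F}|)%N.
  by rewrite !card_sum card_option !mulSn addn0 addn1 !addnS addnA.
apply: (@good_family _ _ _ _ column3 column3_cover).
(* Each of the coordinates 0, 3, 4 vanishes on two of the three families. *)
- exists (fun k : 'I_3 => inord (nth 0%N [:: 0; 3; 4]%N k)) => p k k'.
  case: p => [[b|c]|c]; case: k k' => [[|[|[|]]]] // ? [[|[|[|]]]] // ?;
    rewrite !mxE !inordK //= ?eqxx // => _ _; exact: val_inj.
- exact: column3_inj.
- have [t [t0 t1 _]] := ex_neq01N1.
  exists (inl (inr 0)), (inl (inr 1)), (inl (inr t)), (t - 1), (- t), 1.
  split; rewrite ?subr_eq0 //.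
  + by rewrite eq_sym; apply/eqP => -[/eqP]; rewrite oner_eq0.
  + by apply: contraNneq t0 => -[<-].
  + apply/colP => -[[|[|[|[|[|[|]]]]]]] //= ?; rewrite !mxE /=; ring.
Qed.

(** * Assembling the blocks *)

Lemma good_code_ge2 R : (2 <= R)%N ->
  good_code F R (R * #|F| + ceil_div R 3) (2 * R).
Proof.
elim/ltn_ind: R => -[|[|[|[|[|R]]]]] IH // _.
- exact: good_code2.
- exact: good_code3.
(* Removing 3 would leave radius 1, hence 4 = 2 + 2; the two extra columns match the rounded-up
   value of 4/3. *)
- have := good_codeD good_code2 good_code2.
  by rewrite addnACA -mulnDl.
- have RE : (R.+4.+1 = R.+2 + 3)%N by rewrite addn3.
  have := good_codeD (IH R.+2 _ isT) good_code3.
  (* The single extra column of the radius-3 block matches the growth of the ceiling by one. *)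
  have -> : ceil_div R.+4.+1 3 = (ceil_div R.+2 3 + 1)%N.
    by rewrite RE /ceil_div /= addnAC divnDr ?divnn.
  by rewrite addnACA -mulnDl -(mulnDr 2 _ 3) -RE; apply; lia.
Qed.

End Blocks.

Theorem theorem20 (R q : nat) (F : finFieldType) (hR : 4 <= R) (hq : 4 <= q)
    (hF : #|F| = q) :
  exists (n : nat) (C : {vspace 'rV[F]_n}),
    [/\ n = R * q + ceil_div R 3,
        linear_code (n - 2 * R) 3 C,
        covering_radius C R &
        exists l : nat, 1 <= l /\ Rl_object C R l].
Proof.
rewrite -hF in hq *.
have [|C [lin rad obj]] := good_code_covering _ (good_code_ge2 hq (ltnW (ltnW hR))).
  exact: ltnW.
by exists (R * #|F| + ceil_div R 3), C.
Qed.
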